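(* There exist absolute constants $c, C>0$ such that the following holds. Let $0<\varepsilon\le 1/40$, let $t,m$ be positive integers with $t>1/\varepsilon^{6}$, and let $S\subseteq\{v_1,\dots,v_t\}$. Then for every value $d$ with $\mathbb{P}[d_m^t(S)=d]>0$, $$\mathbb{P}\Bigl[(1-\varepsilon)\sqrt{\tfrac{n}{t}}\,d_m^t(S) < d_m^n(S) < (1+\varepsilon)\sqrt{\tfrac{n}{t}}\,d_m^t(S)\ \text{ for all integers } n\ge t \Bigm| d_m^t(S)=d\Bigr]\ \ge\ 1-\ln(15t)\,e^{-c\,\varepsilon^{C} d}.$$
   Context: Preferential attachment process. For $m=1$: $G_1^1$ is a single vertex $v_1$ with one self-loop. For $t\ge2$, $G_1^t$ is obtained from $G_1^{t-1}$ (vertex set $\{v_1,\dots,v_{t-1}\}$) by adding a new vertex $v_t$ together with one edge from $v_t$ to $v_s$, where $s\in\{1,\dots,t\}$ is chosen at random (given the past) with probability $d_1^{t-1}(v_s)/(2t-1)$ for $s<t$ and $1/(2t-1)$ for $s=t$ (a self-loop at $v_t$). Here $d_1^t(v)$ is the degree of $v$ in $G_1^t$, a self-loop contributing $2$. For general $m\ge1$, $G_m^t$ is obtained from $G_1^{mt}$ (vertices $v'_1,\dots,v'_{mt}$) by merging, for each $i\le t$, the vertices $v'_{(i-1)m+1},\dots,v'_{im}$ into one vertex $v_i$, keeping all edges (so $G_m^t$ is a multigraph with loops); this couples $G_m^1,G_m^2,\dots$ into a single random process. $d_m^t(v)$ denotes the degree of $v$ in $G_m^t$ and $d_m^t(S)=\sum_{v\in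 S}d_m^t(v)$ for a vertex set $S$. *)

(* Defs.v *)
From HB Require Import structures.
From mathcomp Require Import all_boot all_order all_algebra.
From mathcomp Require Import all_classical all_reals all_analysis.
Set Implicit Arguments.
Unset Strict Implicit.
Unset Printing Implicit Defensive.
Import Order.TTheory GRing.Theory Num.Theory.
Local Open Scope classical_set_scope.
Local Open Scope ring_scope.

(* Vertices are numbered from 0: the natural number i stands for v_{i+1}, so
   that the vertex set {v_1, ..., v_t} is {0, ..., t-1}. A multigraph on it is
   given by the list of its edges; (i, i) is a loop. *)
Definition multigraph := seq (nat * nat).

(* A loop contributes 2. *)
Definition degree (G : multigraph) (v : nat) : nat :=
  (\sum_(e <- G) ((e.1 == v) + (e.2 == v)))%N.

(* The graph G_1^t when each new vertex k sends its edge to vertex x k. *)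
Definition G1 (x : nat -> nat) (t : nat) : multigraph :=
  [seq (k, x k) | k <- iota 0 t].

(* G_m^t: the vertices i * m, ..., i * m + m - 1 of G_1^{mt} become vertex i. *)
Definition Gm (m : nat) (x : nat -> nat) (t : nat) : multigraph :=
  [seq (e.1 %/ m, e.2 %/ m)%N | e <- G1 x (m * t)].

(* d_m^n(S) for S a subset of {v_1, ..., v_t}; n may differ from t. *)
Definition set_degree (m : nat) (x : nat -> nat) (n t : nat) (S : {set 'I_t}) :
    nat :=
  (\sum_(v in S) degree (Gm m x n) v)%N.

Definition cond_prob (d : measure_display) (T : measurableType d)
    (R : realType) (P : probability T R) (A B : set T) : R :=
  fine (P (A `&` B)) / fine (P B).

(* X k is the random target of the edge sent by vertex k, i.e. by v_t with
   t = k + 1, whence 2t - 1 = 2k + 1. The event conditioned on fixes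
   the targets chosen before, equivalently the graph G_1^k. For k = 0 the only
   possible target is 0, which gives the initial loop. *)
Record preferential_attachment (d : measure_display) (T : measurableType d)
    (R : realType) (P : probability T R) (X : nat -> {RV P >-> nat}) : Prop := {
  pa_range : forall (k : nat) (w : T), (X k w <= k)%N ;
  pa_law : forall (k : nat) (h : nat -> nat) (s : nat), (s <= k)%N ->
    let past := [set w | forall j : nat, (j < k)%N -> X j w = h j] in
    (0 < P past)%E ->
    cond_prob P [set w | X k w = s] past =
      (if (s < k)%N then degree (G1 h k) s else 1%N)%:R / (2 * k + 1)%:R }.

(* Main.v *)
(* Merging vertices turns S into a vertex set S' of G_1, all of whose members
   are present from time N = m t on, and from then on the degree D_k of S' in
   G_1^k is a pure birth chain: it grows by 1 with probability D_k / (2k + 1).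
   By Bernoulli's inequality, x_k ^ D_k is a nonnegative supermartingale as soon
   as x_{k+1} (1 + (x_{k+1} - 1) / (2k + 1)) <= x_k, which holds both for
   x_k = 1 / (1 - v sqrt (N / k)) and for
   x_k = 1 / (1 + v sqrt ((2N + 1) / (2k + 1))).  Doob's maximal inequality with
   v = eps / 4 bounds each of the two tails by e^(- eps^2 d / 16), uniformly in
   time, so the logarithmic factor is only needed to absorb a factor 2. *)
Require Import Defs.
From HB Require Import structures.
From mathcomp Require Import all_boot all_order all_algebra.
From mathcomp Require Import all_classical all_reals all_analysis.
From mathcomp Require Import ring lra.
Import Order.TTheory GRing.Theory Num.Theory.
Set Implicit Arguments.
Unset Strict Implicit.
Unset Printing Implicit Defensive.
Local Open Scope classical_set_scope.
Local Open Scope ring_scope.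

(** * Bernoulli's inequality and the degree of a vertex set *)

Lemma bernoulli_ineq (R : realFieldType) (y : R) (n : nat) :
  -1 <= y -> 1 + n%:R * y <= (1 + y) ^+ n.
Proof.
move=> y1; elim: n => [|n IH]; first by rewrite expr0 mul0r addr0.
rewrite exprS; apply: (@le_trans _ _ ((1 + y) * (1 + n%:R * y))).
  rewrite -natr1 -subr_ge0.
  have -> : (1 + y) * (1 + n%:R * y) - (1 + (n%:R + 1) * y) =
    n%:R * y ^+ 2 by ring.
  by rewrite mulr_ge0 ?sqr_ge0.
by rewrite ler_wpM2l //; lra.
Qed.

(** The total degree of [A] in [G1 x k], counted by edge ends rather than by vertices. *)
Definition weight (A : pred nat) (x : nat -> nat) (k : nat) : nat :=
  (\sum_(j < k) (A j + A (x j)))%N.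

Definition extend (h : nat -> nat) (k s : nat) : nat -> nat :=
  fun j => if j == k then s else h j.

Lemma eq_weight (A : pred nat) x y k :
  (forall j, (j < k)%N -> x j = y j) -> weight A x k = weight A y k.
Proof. by move=> xy; apply: eq_bigr => j _; rewrite xy. Qed.

Lemma weight_extend (A : pred nat) h k s :
  weight A (extend h k s) k.+1 = (weight A h k + (A k + A s))%N.
Proof.
rewrite /weight big_ord_recr /= {2}/extend eqxx; congr (_ + _)%N.
by apply: eq_bigr => j _; rewrite /extend ltn_eqF.
Qed.

Lemma sum_pred_eq (A : pred nat) (k j : nat) :
  (j < k)%N -> (\sum_(s < k) A s * (j == s :> nat))%N = A j.
Proof.
move=> jk; rewrite (bigD1 (Ordinal jk)) //= eqxx muln1 big1 ?addn0 // => i.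
by rewrite -val_eqE /= eq_sym => /negbTE ->; rewrite muln0.
Qed.

Lemma degree_G1 x k s :
  degree (G1 x k) s = (\sum_(j < k) ((j == s :> nat) + (x j == s)))%N.
Proof.
by rewrite /degree /G1 big_map -(big_mkord xpredT
  (fun j => (j == s) + (x j == s))%N) /index_iota subn0.
Qed.

(** Double counting of edge ends. The range hypothesis keeps every target below [k], so that no end
    is lost in the sum over vertices. *)
Lemma weight_degree (A : pred nat) h k :
  (forall j, (j < k)%N -> (h j <= j)%N) ->
  (\sum_(s < k) A s * degree (G1 h k) s)%N = weight A h k.
Proof.
move=> hr; under eq_bigr do rewrite degree_G1 big_distrr /=.
rewrite exchange_big /=; apply: eq_bigr => j _.
under eq_bigr do rewrite mulnDr.
by rewrite big_split /= !sum_pred_eq // (leq_ltn_trans (hr j _)).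
Qed.

Lemma set_degreeE m x n t (S : {set 'I_t}) : set_degree m x n S =
  weight (fun j => [exists v in S, v == (j %/ m)%N :> nat]) x (m * n).
Proof.
rewrite /set_degree /weight.
(* At most one [v] in [S] equals [u], so the sum is an indicator. *)
have E u : (\sum_(v in S) (u == v :> nat))%N =
    [exists v in S, v == u :> nat] :> nat.
  case: existsP => [[v /andP[vS /eqP <-]]|nex].
    rewrite (bigD1 v) //= eqxx big1 ?addn0 // => i /andP[_].
    by rewrite -val_eqE /= eq_sym => /negbTE ->.
  rewrite big1 // => v vS; apply/eqP; rewrite eqb0 eq_sym.
  by apply/negP => vu; apply: nex; exists v; rewrite vS.
rewrite [RHS](eq_bigr (fun j : 'I_(m * n) => (\sum_(v in S)
   ((j %/ m == v :> nat) + (x j %/ m == v :> nat)))%N)); last first.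
  by move=> j _; rewrite big_split /= !E.
rewrite [RHS]exchange_big /=; apply: eq_bigr => v _.

by rewrite /degree /Gm /G1 !big_map -(big_mkord xpredT
  (fun j => (j %/ m == v) + (x j %/ m == v))%N) /index_iota subn0.
Qed.

(** * One step of the birth chain and the two supermartingale bases *)

Definition trans_prob (R : realFieldType) (h : nat -> nat) (k s : nat) : R :=
  (if (s < k)%N then degree (G1 h k) s else 1%N)%:R / (2 * k + 1)%:R.

(** As [k] lies outside [A], the weight grows by 1 exactly when the target lies in [A], an event of
    probability weight / (2k + 1); a loop at [k] leaves it unchanged. *)
Lemma sum_trans_weight (R : realFieldType) (A : pred nat)
    (h : nat -> nat) (k : nat) (y : R) :
  (forall j, (j < k)%N -> (h j <= j)%N) -> ~~ A k ->
  \sum_(s < k.+1) trans_prob R h k s * y ^+ weight A (extend h k s) k.+1 =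
  y ^+ weight A h k * (1 + (weight A h k)%:R * ((y - 1) / (2 * k + 1)%:R)).
Proof.
move=> hr Ak; rewrite /trans_prob.
have q0 : (2 * k + 1)%:R != 0 :> R by rewrite pnatr_eq0 addn1.
have qE : (2 * k)%:R = (2 * k + 1)%:R - 1 :> R by rewrite natrD addrK.
move: (2 * k + 1)%:R q0 qE => q q0 qE.
have sum_degree : (\sum_(s < k) degree (G1 h k) s = 2 * k)%N.
  rewrite (eq_bigr (fun s : 'I_k => predT s * degree (G1 h k) s)%N).
    rewrite (weight_degree predT) // /weight (eq_bigr (fun=> 2%N)) //.
    by rewrite sum_nat_const card_ord mulnC.
  by move=> s _; rewrite mul1n.
rewrite big_ord_recr /= ltnn weight_extend (negbTE Ak) !addn0 /=.
under eq_bigr => s _ do rewrite ltn_ord weight_extend (negbTE Ak) /= add0n.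
(* Since [A s] is 0 or 1, y ^ (A s) = 1 + (y - 1) A s. *)
have dE (s : 'I_k) : (degree (G1 h k) s)%:R / q * y ^+ (weight A h k + A s) =
    y ^+ weight A h k / q * ((degree (G1 h k) s)%:R +
      (y - 1) * (A s * degree (G1 h k) s)%:R).
  rewrite exprD; case: (A s); rewrite /= ?mul1n ?mul0n;
    by move: (degree _ _)%:R (y ^+ weight _ _ _) => a b; field.
under eq_bigr do rewrite dE.
rewrite -mulr_sumr big_split /= -mulr_sumr -!natr_sum weight_degree //.
rewrite sum_degree qE.
move: (weight A h k)%:R (y ^+ _) => a b.
by field.
Qed.

Lemma weight_step (R : realFieldType) (D k : nat) (x y : R) :
  0 < y -> y * (1 + (y - 1) / (2 * k + 1)%:R) <= x ->
  y ^+ D * (1 + D%:R * ((y - 1) / (2 * k + 1)%:R)) <= x ^+ D.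
Proof.
move=> y0 yx; pose q : R := (2 * k + 1)%:R.
have q1 : 1 <= q by rewrite ler1n addn1.
have z1 : -1 <= (y - 1) / q.
  by rewrite ler_pdivlMr; lra.
have z2 : 0 <= 1 + (y - 1) / q.
  by lra.
apply: (@le_trans _ _ (y ^+ D * (1 + (y - 1) / q) ^+ D)).
  by rewrite ler_wpM2l ?exprn_ge0 ?bernoulli_ineq // ltW.
rewrite -exprMn lerXn2r ?nnegrE //; first by rewrite mulr_ge0 // ltW.
by apply: le_trans yx; rewrite mulr_ge0 // ltW.
Qed.

(* The form 1 / (1 - v) is the one for which generating functions of the Yule
   process, the continuous-time analogue, evolve by scaling v. *)
Lemma inv_base_step (R : realFieldType) (k : nat) (u v : R) : u < 1 -> v < 1 ->
  (1 - u) * (1 - v + v / (2 * k + 1)%:R) <= (1 - v) ^+ 2 ->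
  (1 - v)^-1 * (1 + ((1 - v)^-1 - 1) / (2 * k + 1)%:R) <= (1 - u)^-1.
Proof.
move=> u1 v1 H; have q0 : 0 < (2 * k + 1)%:R :> R by rewrite ltr0n addn1.
move: H q0; set q : R := (2 * k + 1)%:R => H q0.
have -> : (1 - v)^-1 * (1 + ((1 - v)^-1 - 1) / q) =
    (1 - v + v / q) / (1 - v) ^+ 2 by field; lra.
rewrite ler_pdivrMr ?exprn_gt0 ?subr_gt0 // [leRHS]mulrC.
by rewrite ler_pdivlMr ?subr_gt0 // mulrC.
Qed.

(** With q = 1 / (2k + 1), (1 + q)^2 <= (k + 1) / k, so b_k >= b_{k+1} (1 + q). Substituting this
    bound for b_k turns the left side into (1 - b_{k+1})^2 - (q b_{k+1})^2. *)
Lemma upper_base_step (R : realType) (N k : nat) (v : R)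
    (b := fun j : nat => v * Num.sqrt (N%:R / j%:R)) :
  (0 < N)%N -> (N <= k)%N -> 0 <= v -> v < 1 ->
  (1 - b k) * (1 - b k.+1 + b k.+1 / (2 * k + 1)%:R) <= (1 - b k.+1) ^+ 2.
Proof.
move=> N0 Nk v0 v1.
have k0 : 0 < k%:R :> R by rewrite ltr0n (leq_trans N0).
have b0 j : 0 <= b j by rewrite mulr_ge0 ?sqrtr_ge0.
have b1 j : (N <= j)%N -> b j < 1.
  move=> Nj; apply: le_lt_trans v1; rewrite -[leRHS]mulr1 ler_wpM2l //.
  rewrite -[leRHS]sqrtr1 ler_wsqrtr // ler_pdivrMr ?mul1r ?ler_nat //.
  by rewrite ltr0n (leq_trans N0).
have b1' : b k.+1 < 1 by rewrite b1 // (leq_trans Nk).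
have := b0 k.+1; move: (b1 k Nk).
have bS : b k.+1 * (1 + (2 * k + 1)%:R^-1) <= b k.
  rewrite -mulrA ler_wpM2l //.
  have -> : 1 + (2 * k + 1)%:R^-1 = (2 * k + 2)%:R / (2 * k + 1)%:R :> R.
    rewrite !natrD; field; rewrite ?natrM; lra.
  have p1 : 0 <= (2 * k + 2)%:R / (2 * k + 1)%:R :> R by rewrite divr_ge0.
  rewrite -[X in _ * X](ger0_norm p1) -sqrtr_sqr -sqrtrM ?divr_ge0 //.
  rewrite ler_wsqrtr // -mulrA ler_wpM2l // natrD natrM -natr1.
  rewrite -subr_ge0.
  have -> : k%:R^-1 - (k%:R + 1)^-1 * ((2 * k%:R + 2%:R) / (2 * k + 1)%:R) ^+ 2
    = (k%:R * (2 * k%:R + 1) ^+ 2)^-1 :> R.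
    by rewrite natrD natrM; field; lra.
  by rewrite invr_ge0 mulr_ge0 // ?sqr_ge0 // ltW.
have q0 : 0 < (2 * k + 1)%:R^-1 :> R by rewrite invr_gt0 ltr0n addn1.
move: bS q0 b1'; move: ((2 * k + 1)%:R^-1) (b k) (b k.+1) => q u w.
move=> h q0 w1 u1 w0.
apply: (@le_trans _ _ ((1 - w * (1 + q)) * (1 - w + w * q))).
  rewrite ler_wpM2r ?lerB // addr_ge0 ?subr_ge0 ?mulr_ge0 // ltW //.
have -> : (1 - w) ^+ 2 = (1 - w * (1 + q)) * (1 - w + w * q) + (w * q) ^+ 2.
  by ring.
by rewrite lerDl sqr_ge0.
Qed.

(** Here [b] enters with the opposite sign, so the reverse bound b_k <= b_{k+1} (1 + q) is required.
    The sequence sqrt (N / k) violates it; the shift to 2k + 1 restores it, because (2k + 2)^2 >=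
    (2k + 1) (2k + 3). *)
Lemma lower_base_step (R : realType) (N k : nat) (v : R)
    (b := fun j : nat => v * Num.sqrt ((2 * N + 1)%:R / (2 * j + 1)%:R)) :
  0 <= v ->
  (1 + b k) * (1 + b k.+1 - b k.+1 / (2 * k + 1)%:R) <= (1 + b k.+1) ^+ 2.
Proof.
move=> v0.
have k0 : 0 <= k%:R :> R by [].
have b0 j : 0 <= b j by rewrite mulr_ge0 ?sqrtr_ge0.
have bS : b k <= b k.+1 * (1 + (2 * k + 1)%:R^-1).
  rewrite -mulrA ler_wpM2l //.
  have -> : 1 + (2 * k + 1)%:R^-1 = (2 * k + 2)%:R / (2 * k + 1)%:R :> R.
    by rewrite !natrD; field; rewrite ?natrM; lra.
  have p1 : 0 <= (2 * k + 2)%:R / (2 * k + 1)%:R :> R by rewrite divr_ge0.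
  rewrite -[X in _ <= _ * X](ger0_norm p1) -sqrtr_sqr -sqrtrM ?divr_ge0 //.
  rewrite ler_wsqrtr // -mulrA ler_wpM2l //.
  have -> : (2 * k.+1 + 1)%:R = 2 * (k%:R + 1) + 1 :> R.
    by rewrite natrD natrM -(natr1 k).
  have -> : (2 * k + 1)%:R = 2 * k%:R + 1 :> R by rewrite natrD natrM.
  have -> : (2 * k + 2)%:R = 2 * k%:R + 2 :> R by rewrite natrD natrM.
  rewrite -subr_ge0.
  have -> : (2 * (k%:R + 1) + 1)^-1 * ((2 * k%:R + 2) / (2 * k%:R + 1)) ^+ 2
    - (2 * k%:R + 1)^-1 = ((2 * k%:R + 3) * (2 * k%:R + 1) ^+ 2)^-1 :> R.
    by field; lra.
  by rewrite invr_ge0 mulr_ge0 // ?sqr_ge0 //; lra.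
have q1 : (2 * k + 1)%:R^-1 <= 1 :> R by rewrite invf_le1 ?ler1n ?ltr0n addn1.
have q0 : 0 <= (2 * k + 1)%:R^-1 :> R by rewrite invr_ge0.
move: bS q0 q1 (b0 k) (b0 k.+1).
move: ((2 * k + 1)%:R^-1) (b k) (b k.+1) => q u w h q0 q1 u0 w0.
have wq : w * q <= w by rewrite ler_piMr.
apply: (@le_trans _ _ ((1 + w * (1 + q)) * (1 + w - w * q))).
  by rewrite ler_wpM2r ?lerD2l // -addrA addr_ge0 // subr_ge0.
have -> : (1 + w) ^+ 2 = (1 + w * (1 + q)) * (1 + w - w * q) + (w * q) ^+ 2.
  by ring.
by rewrite lerDl sqr_ge0.
Qed.

(** * Histories as a finitely branching tree, and their probabilities *)

Section history.
Context (d : measure_display) (T : measurableType d) (R : realType).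
Context (P : probability T R) (X : nat -> {RV P >-> nat}).
Context (paX : preferential_attachment X).

Definition pr (A : set T) : R := fine (P A).

Definition event (Q : set (nat -> nat)) : set T :=
  [set w | Q (fun j => X j w)].

Definition past (h : nat -> nat) (k : nat) : set T :=
  [set w | forall j, (j < k)%N -> X j w = h j].

(** Stands in for membership in the sigma-algebra of the first [K] targets. One implication
    suffices, as [x] and [y] may be exchanged. *)
Definition determined (K : nat) (Q : set (nat -> nat)) :=
  forall x y, (forall j, (j < K)%N -> x j = y j) -> Q x -> Q y.

Let prE A : measurable A -> P A = (pr A)%:E.
Proof. by move=> mA; rewrite /pr fineK //; exact: fin_num_measure. Qed.

Lemma pr_ge0 A : 0 <= pr A.
Proof. by rewrite fine_ge0. Qed.

Lemma le_pr A B : measurable A -> measurable B -> A `<=` B -> pr A <= pr B.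
Proof.
by move=> mA mB AB; rewrite -lee_fin -!prE // le_measure ?inE.
Qed.

Lemma pr_le_setU A B C : measurable A -> measurable B -> measurable C ->
  C `<=` A `|` B -> pr C <= pr A + pr B.
Proof.
move=> mA mB mC CAB; have mU := measurableU _ _ mA mB.
apply: le_trans (le_pr mC mU CAB) _.
by rewrite -lee_fin EFinD -!prE // measureU2.
Qed.

Lemma extendS h k s j : (j < k)%N -> extend h k s j = h j.
Proof. by move=> jk; rewrite /extend ltn_eqF. Qed.

Lemma past_extend h k s :
  past (extend h k s) k.+1 = [set w | X k w = s] `&` past h k.
Proof.
apply/seteqP; split=> w /=.
  move=> H; split; first by rewrite H // /extend eqxx.
  by move=> j jk; rewrite H ?extendS // ltnW.
move=> [Xs H] j; rewrite ltnS leq_eqVlt => /orP[/eqP ->|jk].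
  by rewrite Xs /extend eqxx.
by rewrite extendS // H.
Qed.

Lemma measurable_eq k s : measurable [set w | X k w = s].
Proof.
have -> : [set w | X k w = s] = X k @^-1` [set s] by [].
exact: measurable_funPTI.
Qed.

Lemma measurable_past h k : measurable (past h k).
Proof.
elim: k => [|k IH].
  by rewrite (_ : past h 0 = setT) //; apply/seteqP; split.
have -> : past h k.+1 = past (extend h k (h k)) k.+1.
  by apply/seteqP; split=> w H j jk; rewrite H // /extend; case: eqP => // ->.
by rewrite past_extend; apply: measurableI => //; exact: measurable_eq.
Qed.

(** The bound [X k w <= k] makes the branching finite, so finite unions and sums suffice at each
    step. *)
Lemma past_split h k (A : set T) : past h k `&` A =
  \big[setU/set0]_(s < k.+1) (past (extend h k s) k.+1 `&` A).
Proof.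
rewrite -(bigcup_mkord k.+1 (fun s => past (extend h k s) k.+1 `&` A)).
apply/seteqP; split=> w /=.
  move=> [H Aw]; exists (X k w); first by rewrite /= ltnS (pa_range paX).
  by split=> //; rewrite past_extend.
by move=> [s _ []]; rewrite past_extend => -[].
Qed.

Lemma past_event K (Q : set (nat -> nat)) h k : determined K Q -> (K <= k)%N ->
  past h k `&` event Q = past h k /\ Q h \/
  past h k `&` event Q = set0 /\ ~ Q h.
Proof.
move=> dQ Kk; have [Qh|nQ] := pselect (Q h); [left|right]; split=> //.
  apply/seteqP; split=> w; first by case.
  move=> H; split=> //; apply: (dQ h) => // j jK.
  by rewrite H // (leq_trans jK).
apply/seteqP; split=> w [] // H Qw.
by apply: nQ; apply: (dQ _ _ _ Qw) => j jK; rewrite H // (leq_trans jK).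
Qed.

(** Descending the tree to depth [K] writes the event as a finite union of pasts, on each of which
    [Q] holds everywhere or nowhere. *)
Lemma measurable_event K (Q : set (nat -> nat)) :
  determined K Q -> measurable (event Q).
Proof.
move=> dQ.
suff H n h k : (K <= k + n)%N -> measurable (past h k `&` event Q).
  have := H K (fun=> 0%N) 0%N (leqnn _); rewrite (_ : past _ 0 = setT).
    by rewrite setTI.
  by apply/seteqP; split.
elim: n h k => [|n IH] h k Kk.
  rewrite addn0 in Kk; case: (past_event h dQ Kk) => -[-> _] //.
  exact: measurable_past.
rewrite past_split; apply: bigsetU_measurable => s _; apply: IH.
by rewrite addSnnS.
Qed.

Lemma pr_split h k (A : set T) : measurable A ->
  pr (past h k `&` A) = \sum_(s < k.+1) pr (past (extend h k s) k.+1 `&` A).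
Proof.
move=> mA; apply: EFin_inj; rewrite -sumEFin -prE; last first.
  by apply: measurableI => //; exact: measurable_past.
have mF s : measurable (past (extend h k s) k.+1 `&` A).
  by apply: measurableI => //; exact: measurable_past.
under eq_bigr do rewrite -prE //.
rewrite past_split measure_semi_additive_ord //; last exact: bigsetU_measurable.
move=> i j _ _ [w [[Hi _] [Hj _]]]; apply: val_inj => /=.
by move: (Hi k (ltnSn k)) (Hj k (ltnSn k)); rewrite /extend eqxx => -> ->.
Qed.

Lemma pr_past_extend h k s : (s <= k)%N ->
  pr (past (extend h k s) k.+1) = pr (past h k) * trans_prob R h k s.
Proof.
move=> sk; have mp := measurable_past h k; rewrite past_extend.
(* [pa_law] is silent about null pasts; there both sides vanish. *)
have [p0|p0] := eqVneq (pr (past h k)) 0.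
  rewrite p0 mul0r; apply: le_anti; rewrite pr_ge0 andbT -p0.
  by apply: le_pr => //; apply: measurableI => //; exact: measurable_eq.
have Pp : (0 < P (past h k))%E by rewrite prE // lte_fin lt_def p0 pr_ge0.
rewrite /trans_prob -(pa_law paX sk Pp) /cond_prob -!/(pr _) mulrC.
by rewrite divfK.
Qed.

(** The inequality is linear in both measures, so it may be checked on each admissible history of
    length [N] and summed. *)
Lemma past_ind N (A B : set T) (r : R) : measurable A -> measurable B ->
  (forall h, (forall j, (j < N)%N -> (h j <= j)%N) ->
    pr (past h N `&` A) <= r * pr (past h N `&` B)) ->
  pr A <= r * pr B.
Proof.
move=> mA mB H.
suff G n h k : (k + n)%N = N -> (forall j, (j < k)%N -> (h j <= j)%N) ->
    pr (past h k `&` A) <= r * pr (past h k `&` B).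
  have := G N (fun=> 0%N) 0%N erefl; rewrite (_ : past _ 0 = setT).
    by rewrite !setTI; apply.
  by apply/seteqP; split.
elim: n h k => [|n IH] h k kn hr.
  by rewrite addn0 in kn; rewrite kn in hr *; apply: H.
rewrite !pr_split // mulr_sumr; apply: ler_sum => s _; apply: IH.
  by rewrite addSnnS.
move=> j; rewrite ltnS leq_eqVlt => /orP[/eqP ->|jk].
  by rewrite /extend eqxx -ltnS.
by rewrite extendS // hr.
Qed.

(** * Doob's maximal inequality *)

Section maximal.
Context (N : nat) (phi : nat -> (nat -> nat) -> R).
Context (phi_local : forall k x y,
  (forall j, (j < k)%N -> x j = y j) -> phi k x = phi k y).
Context (phi_ge0 : forall k x, (N <= k)%N -> 0 <= phi k x).
Context (phi_super : forall k h, (N <= k)%N ->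
  (forall j, (j < k)%N -> (h j <= j)%N) ->
  \sum_(s < k.+1) trans_prob R h k s * phi k.+1 (extend h k s) <= phi k h).

Definition exceeds k n : set (nat -> nat) :=
  [set x | exists2 j, (k <= j <= k + n)%N & 1 <= phi j x].

Lemma determined_exceeds k n : determined (k + n) (exceeds k n).
Proof.
move=> x y xy [j /andP[kj jn] p]; exists j; rewrite ?kj //.
rewrite -(@phi_local j x) // => i ij; apply: xy; exact: leq_trans jn.
Qed.

(** First-step analysis instead of a stopping time: if [phi k h] is at least 1 the bound is trivial;
    otherwise level 1 can only be reached later, and the supermartingale property averages the
    bounds for the possible next targets. *)
Lemma maximal_past n k h : (N <= k)%N ->
  (forall j, (j < k)%N -> (h j <= j)%N) ->
  pr (past h k `&` event (exceeds k n)) <= pr (past h k) * phi k h.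
Proof.
elim: n k h => [|n IH] k h Nk hr; have mp := measurable_past h k.
all: have [p1|p1] := leP 1 (phi k h).
(* The first and third goals are the trivial case, for horizon 0 and for the induction step. *)
1,3: apply: (@le_trans _ _ (pr (past h k))); last by rewrite ler_peMr ?pr_ge0.
1,2: apply: le_pr => //; apply: measurableI => //.
1,2: exact: measurable_event (@determined_exceeds _ _).
  rewrite (_ : _ `&` _ = set0) /pr ?measure0 ?mulr_ge0 ?fine_ge0 ?phi_ge0 //.
  apply/seteqP; split=> w [] // H [j]; rewrite addn0 -eqn_leq => /eqP <-.
  by rewrite (phi_local H) leNgt p1.
have -> : past h k `&` event (exceeds k n.+1) =
    past h k `&` event (exceeds k.+1 n).
  apply/seteqP; split=> w [H [j /andP[kj jn] pj]]; split=> //; exists j => //.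
    rewrite -addSnnS in jn; rewrite jn andbT ltn_neqAle kj andbT.
    by apply: contraTneq pj => <-; rewrite (phi_local H) -ltNge.
  by rewrite (ltnW kj) -addSnnS jn.
rewrite pr_split; last exact: measurable_event (@determined_exceeds _ _).
apply: le_trans (ler_wpM2l (pr_ge0 _) (phi_super Nk hr)).
rewrite mulr_sumr; apply: ler_sum => s _.
rewrite mulrA -pr_past_extend; last by rewrite -ltnS.
apply: IH; first exact: ltnW.
move=> j; rewrite ltnS leq_eqVlt => /orP[/eqP ->|jk].
  by rewrite /extend eqxx -ltnS.
by rewrite extendS // hr.
Qed.

(** [Q] is all or nothing on each past of length [N], which localizes the bound to [Q]; continuity
    from below along growing windows then removes the finite horizon. *)
Lemma maximal_ineq (Q : set (nat -> nat)) (r : R) : determined N Q ->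
  (forall x, Q x -> phi N x <= r) ->
  let A := event [set x | exists2 j, (N <= j)%N & 1 <= phi j x] in
  measurable A /\ pr (A `&` event Q) <= r * pr (event Q).
Proof.
move=> dQ Qr A; have mQ := measurable_event dQ.
have mE n : measurable (event (exceeds N n)).
  exact: measurable_event (@determined_exceeds _ _).
have AE : A = \bigcup_n event (exceeds N n).
  apply/seteqP; split=> w /=.
    move=> [j Nj pj]; exists (j - N)%N => //; exists j; last by [].
    by rewrite ?subnKC ?Nj /=.
  by move=> [n _ [j /andP[Nj _] pj]]; exists j.
have mA : measurable A by rewrite AE; exact: bigcup_measurable.
split=> //.
have H n : pr (event (exceeds N n) `&` event Q) <= r * pr (event Q).
  apply: (@past_ind N) => //; first exact: measurableI.
  move=> h hr; case: (past_event h dQ (leqnn N)) => -[E Qh].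
    rewrite E; apply: le_trans (_ : pr (past h N) * phi N h <= _).
      have mp := measurable_past h N.
      apply: le_trans (maximal_past n (leqnn N) hr).
      apply: le_pr; [|exact: measurableI|by move=> w [? []]].
      by do 2?apply: measurableI.
    by rewrite mulrC ler_wpM2r ?pr_ge0 ?Qr.
  by rewrite [X in past _ _ `&` X]setIC setIA E set0I /pr measure0 mulr0.
pose F n := event (exceeds N n) `&` event Q.
have mF n : measurable (F n) by exact: measurableI.
have AF : A `&` event Q = \bigcup_n F n by rewrite AE setI_bigcupl.
have homoF : {homo F : n m / (n <= m)%N >-> (n <= m)%O}.
  move=> n m nm; rewrite subsetEset; apply: setSI => w [j /andP[Nj jn] pj].
  by exists j; rewrite // Nj (leq_trans jn) ?leq_add2l.
have mU : measurable (\bigcup_n F n) by exact: bigcup_measurable.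
have cv := @nondecreasing_cvg_mu _ _ _ P F mF mU homoF.
rewrite AF -lee_fin -prE // -(cvg_lim _ cv) //.
apply: lime_le; first exact: cvgP cv.
by apply: nearW => n; rewrite /= prE ?lee_fin; [exact: H|exact: mF].
Qed.

End maximal.

(** Conditioning on the weight at time [N] makes the initial value of the supermartingale constant.
    Positive [b] controls large weights; negative [b] gives a base below 1 and controls small
    ones. *)
Lemma weight_maximal (N d0 : nat) (A : pred nat) (b : nat -> R) (theta : R) :
  (forall k, (N <= k)%N -> ~~ A k) -> (forall k, (N <= k)%N -> b k < 1) ->
  (forall k, (N <= k)%N -> (1 - b k) * (1 - b k.+1 + b k.+1 / (2 * k + 1)%:R)
    <= (1 - b k.+1) ^+ 2) ->
  0 < theta ->
  let B := event [set x | weight A x N = d0] in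
  let E := event [set x | exists2 j, (N <= j)%N &
    theta <= (1 - b j)^-1 ^+ weight A x j] in
  measurable E /\ pr (E `&` B) <= (1 - b N)^-1 ^+ d0 / theta * pr B.
Proof.
move=> AN b1 bS th0 B E.
pose phi k x := (1 - b k)^-1 ^+ weight A x k / theta.
have -> : E = event [set x | exists2 j, (N <= j)%N & 1 <= phi j x].
  by apply/seteqP; split=> w [j Nj H]; exists j => //;
    move: H; rewrite /phi ler_pdivlMr ?mul1r.
apply: maximal_ineq.
- by move=> k x y xy; rewrite /phi (eq_weight _ xy).
- move=> k x Nk; rewrite /phi divr_ge0 ?exprn_ge0 ?invr_ge0 ?subr_ge0 // ltW //.
  exact: b1.
- move=> k h Nk hr; rewrite /phi.
  under eq_bigr do rewrite mulrA.
  rewrite -mulr_suml ler_wpM2r ?invr_ge0 ?(ltW th0) // sum_trans_weight ?AN //.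
  have bk1 : b k.+1 < 1 by apply: b1; exact: leqW.
  apply: weight_step; first by rewrite invr_gt0 subr_gt0.
  by apply: inv_base_step => //; [exact: b1 | exact: bS].
- by move=> x y xy <-; apply/esym/eq_weight.
- by move=> x <-.
Qed.

End history.

(** * Exponential and logarithmic estimates *)

Lemma expR_le_inv (R : realType) (y : R) : y < 1 -> expR y <= (1 - y)^-1.
Proof.
move=> y1; rewrite -[y in expR y]opprK expRN.
rewrite lef_pV2 ?posrE ?expR_gt0 ?subr_gt0 //.
exact: expR_ge1Dx.
Qed.

Lemma inv_le_expR (R : realType) (y : R) : y < 1 ->
  (1 - y)^-1 <= expR (y / (1 - y)).
Proof.
move=> y1; apply: le_trans (expR_ge1Dx _).
rewrite le_eqVlt; apply/orP; left; apply/eqP; field; lra.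
Qed.

Lemma inv_pow_le (R : realType) (y e : R) (n : nat) : y < 1 ->
  y / (1 - y) <= e -> (1 - y)^-1 ^+ n <= expR (e * n%:R).
Proof.
move=> y1 ye; rewrite mulrC expRM_natl lerXn2r ?nnegrE ?expR_ge0 //.
  by rewrite invr_ge0 subr_ge0 ltW.
by apply: le_trans (inv_le_expR y1) _; rewrite ler_expR.
Qed.

Lemma inv_pow_ge (R : realType) (y e : R) (n : nat) : y < 1 ->
  e <= y * n%:R -> expR e <= (1 - y)^-1 ^+ n.
Proof.
move=> y1 ye; apply: (@le_trans _ _ (expR (y * n%:R))).
  by rewrite ler_expR.
rewrite mulrC expRM_natl lerXn2r ?nnegrE ?expR_ge0 ?expR_le_inv //.
by rewrite invr_ge0 subr_ge0 ltW.
Qed.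

Lemma sqrt_mulV (R : realType) (a b : R) : 0 < a -> 0 < b ->
  Num.sqrt (a / b) * Num.sqrt (b / a) = 1.
Proof.
move=> a0 b0; rewrite -sqrtrM ?divr_ge0 ?ltW //.
by rewrite mulf_div [b * a]mulrC divff ?sqrtr1 // mulf_neq0 // gt_eqF.
Qed.

(** The shift in the lower base costs a factor of at most 1 + 1 / (4N). As 1 / (4N) <= eps / 4, it
    is paid for by weakening eps to eps / 2. *)
Lemma lower_base_ratio (R : realType) (N j : nat) (eps : R) :
  0 < eps -> eps <= 1 ->
  1 <= eps * N%:R ->
  (1 - eps) * (Num.sqrt ((2 * N + 1)%:R / (2 * j + 1)%:R) *
    Num.sqrt (j%:R / N%:R)) <= 1 - eps / 2.
Proof.
move=> e0 e1 eN; have N0 : 0 < N%:R :> R.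
  by rewrite -(pmulr_rgt0 _ e0); apply: lt_le_trans eN.
have j0 : 0 <= j%:R :> R by [].
have odd_natr k : (2 * k + 1)%:R = 2 * k%:R + 1 :> R by rewrite natrD natrM.
rewrite -sqrtrM ?divr_ge0 // !odd_natr.
have z0 : 0 <= 1 + (4 * N%:R)^-1 :> R by rewrite addr_ge0 ?invr_ge0; lra.
apply: (@le_trans _ _ ((1 - eps) * (1 + (4 * N%:R)^-1))).
  rewrite ler_wpM2l ?subr_ge0 // -[leRHS](ger0_norm z0) -sqrtr_sqr.
  rewrite ler_wsqrtr // -subr_ge0.
  have -> : (1 + (4 * N%:R)^-1) ^+ 2 -
    (2 * N%:R + 1) / (2 * j%:R + 1) * (j%:R / N%:R) =
    ((4 * N%:R)^-1) ^+ 2 + (2 * N%:R + 1) / (2 * N%:R * (2 * j%:R + 1)) :> R.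
    by field; lra.
  by rewrite addr_ge0 ?sqr_ge0 // divr_ge0 ?mulr_ge0; lra.
have : (4 * N%:R)^-1 <= eps / 4.
  rewrite invfM mulrC ler_pM2r ?invr_gt0; last by lra.
  by rewrite -div1r ler_pdivrMr.
have : 0 <= (4 * N%:R : R)^-1 by rewrite invr_ge0; lra.
move: (4 * N%:R)^-1 => z z1 z2; nra.
Qed.

(** Serves to absorb the factor 2 of the union bound: e^(1/2) <= 2 gives e^2 <= 16, while 15 t >=
    30. *)
Lemma ln15_ge2 (R : realType) (t : nat) : (1 < t)%N -> 2 <= ln (15 * t%:R) :> R.
Proof.
move=> t1; have t2 : 2 <= t%:R :> R by rewrite ler_nat.
rewrite -[leLHS]expRK ler_ln ?posrE ?expR_gt0 //; last by lra.
have h : expR (1 / 2) <= 2 :> R.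
  have /expR_le_inv : 1 / 2 < 1 :> R by lra.
  by have -> : (1 - 1 / 2)^-1 = 2 :> R by field.
have -> : 2 = 4%:R * (1 / 2) :> R by lra.
rewrite expRM_natl.
apply: (@le_trans _ _ (2 ^+ 4)); last by lra.
by rewrite lerXn2r ?nnegrE ?expR_ge0.
Qed.

(** * The two tails combined *)

Theorem theorem1 (R : realType) :
  exists c C : R, 0 < c /\ 0 < C /\
    forall (disp : measure_display) (T : measurableType disp)
      (P : probability T R) (X : nat -> {RV P >-> nat}),
    preferential_attachment X ->
    forall (eps : R) (t m : nat) (S : {set 'I_t}),
    0 < eps -> eps <= 1 / 40 ->
    (0 < t)%N -> (0 < m)%N -> 1 / eps ^+ 6 < t%:R ->
    let deg (n : nat) (w : T) := set_degree m (fun k => X k w) n S in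
    forall d : nat,
    (0 < P [set w | deg t w = d])%E ->
    1 - ln (15 * t%:R) * expR (- (c * eps `^ C * d%:R)) <=
    cond_prob P
      [set w | forall n : nat, (t <= n)%N ->
         (1 - eps) * Num.sqrt (n%:R / t%:R) * (deg t w)%:R < (deg n w)%:R
         /\ (deg n w)%:R < (1 + eps) * Num.sqrt (n%:R / t%:R) * (deg t w)%:R]
      [set w | deg t w = d].
Proof.
(* To second order the lower tail at parameter v has exponent (v^2 - v eps / 2) d, minimal at v =
   eps / 4 with value - eps^2 d / 16. *)
exists 16^-1, 2; do 2 split=> //.
move=> disp T P X paX eps t m S e0 e1 t0 m0 et deg d.
set G := [set w | forall n, _]; set B := [set w | deg t w = d] => PB.
rewrite powR_mulrn ?(ltW e0) //.
(* This yields t > 1 for the logarithm and 1 <= eps m t for [lower_base_ratio]. *)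
have et1 : 1 < eps ^+ 6 * t%:R by rewrite mulrC -ltr_pdivrMr ?exprn_gt0.
have e61 : eps ^+ 6 <= eps by rewrite exprS ler_piMr ?exprn_ile1 ?ltW //; lra.
have t1 : 1 < t%:R :> R.
  have : eps ^+ 6 * t%:R <= t%:R by rewrite ler_piMl //; lra.
  lra.
have etN : 1 <= eps * (m * t)%:R.
  apply: le_trans (ltW et1) _; apply: (@le_trans _ _ (eps * t%:R)).
    by rewrite ler_wpM2r.
  by rewrite ler_wpM2l ?(ltW e0) // ler_nat leq_pmull.
have N0 : (0 < m * t)%N by rewrite muln_gt0 m0.
pose A : pred nat := fun j => [exists v in S, v == (j %/ m)%N :> nat].
have degE n w : deg n w = weight A (fun k => X k w) (m * n).
  exact: set_degreeE.
have AN k : (m * t <= k)%N -> ~~ A k.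
  move=> tk; apply/existsP => -[v /andP[_ /eqP vk]].
  by have := ltn_ord v; rewrite vk ltnNge leq_divRL // mulnC tk.
have BE : B = event X [set x | weight A x (m * t) = d].
  by apply/seteqP; split=> w; rewrite /B /event /= degE.
pose b1 k : R := eps / 4 * Num.sqrt ((m * t)%:R / k%:R).
(* The negative sign lets [weight_maximal] cover the lower tail too. *)
pose b2 k : R := - (eps / 4 * Num.sqrt ((2 * (m * t) + 1)%:R / (2 * k + 1)%:R)).
have k0 k : (m * t <= k)%N -> 0 < k%:R :> R.
  by move=> Nk; rewrite ltr0n (leq_trans N0).
have b1_lt1 k : (m * t <= k)%N -> b1 k < 1.
  move=> Nk; apply: (@le_lt_trans _ _ (eps / 4 * 1)); last by lra.
  rewrite ler_wpM2l //; first by lra.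
  rewrite -[leRHS]sqrtr1 ler_wsqrtr //.
  by rewrite ler_pdivrMr ?k0 // mul1r ler_nat.
have b2_le0 k : b2 k <= 0.
  by rewrite oppr_le0 mulr_ge0 ?sqrtr_ge0 //; lra.
have b2_lt1 k : b2 k < 1 by apply: le_lt_trans (b2_le0 k) _; lra.
have b1N : b1 (m * t)%N = eps / 4.
  by rewrite /b1 divff ?sqrtr1 ?mulr1 // gt_eqF // k0.
have b2N : b2 (m * t)%N = - (eps / 4).
  by rewrite /b2 divff ?sqrtr1 ?mulr1 // pnatr_eq0 addn1.
have v0 : 0 <= eps / 4 by lra.
have v1 : eps / 4 < 1 by lra.
have b1S k (Nk : (m * t <= k)%N) := upper_base_step N0 Nk v0 v1.
have b2S k : (m * t <= k)%N ->
    (1 - b2 k) * (1 - b2 k.+1 + b2 k.+1 / (2 * k + 1)%:R) <= (1 - b2 k.+1) ^+ 2.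
  by move=> _; rewrite /b2 !opprK mulNr; exact: lower_base_step.
have [] := weight_maximal paX d AN b1_lt1 b1S
  (expR_gt0 (eps / 4 * (1 + eps) * d%:R)).
set E1 := event X _; rewrite -BE b1N => mE1 pE1.
have [] := weight_maximal paX d AN (fun k _ => b2_lt1 k) b2S
  (expR_gt0 (- (eps / 4 * (1 - eps / 2)) * d%:R)).
set E2 := event X _; rewrite -BE b2N => mE2 pE2.
set e := expR _.
have q1 : (1 - eps / 4)^-1 ^+ d / expR (eps / 4 * (1 + eps) * d%:R) <= e.
  rewrite ler_pdivrMr ?expR_gt0 // /e -expRD -[X in expR (X + _)]mulNr -mulrDl.
  apply: inv_pow_le => //; rewrite ler_pdivrMr ?subr_gt0 //; nra.
have q2 : (1 - - (eps / 4))^-1 ^+ d /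
    expR (- (eps / 4 * (1 - eps / 2)) * d%:R) <= e.
  rewrite ler_pdivrMr ?expR_gt0 // /e -expRD -[X in expR (X + _)]mulNr -mulrDl.
  apply: inv_pow_le; first by lra.
  rewrite ler_pdivrMr; last by lra.
  (* Once the denominator is cleared the quadratic terms cancel, leaving a slack of eps^3 / 64. *)
  have : 0 <= eps ^+ 3 by rewrite exprn_ge0 ?ltW.
  lra.
have mB : measurable B.
  rewrite BE; apply: (@measurable_event _ _ _ _ _ paX (m * t)) => x y xy <-.
  exact/esym/eq_weight.
have prB0 : 0 < pr P B.
  rewrite -lte_fin /pr fineK //; exact: fin_num_measure.
have mG : measurable (G `&` B).
  (* The guard [t <= n] ensures m t <= m n, so that [Q n] depends on the first m n targets only. *)
  pose Q n : set (nat -> nat) := [set x | (t <= n)%N ->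
    (1 - eps) * Num.sqrt (n%:R / t%:R) * (weight A x (m * t))%:R <
      (weight A x (m * n))%:R /\
    (weight A x (m * n))%:R <
      (1 + eps) * Num.sqrt (n%:R / t%:R) * (weight A x (m * t))%:R].
  have -> : G = \bigcap_n event X (Q n).
    apply/seteqP; split=> w.
      by move=> Gw n _ tn; rewrite -!degE; exact: Gw.
    by move=> Gw n tn; rewrite !degE; exact: Gw.
  apply: measurableI => //; apply: bigcapT_measurable => n.
  apply: (@measurable_event _ _ _ _ _ paX (m * n)) => x y xy Qx tn.
  have wE k : (k <= m * n)%N -> weight A x k = weight A y k.
    by move=> kn; apply: eq_weight => j jk; apply: xy; exact: leq_trans kn.
  by have := Qx tn; rewrite !wE // leq_pmul2l.
have natE n : (m * n)%:R / (m * t)%:R = n%:R / t%:R :> R.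
  by rewrite !natrM -mulf_div divff ?mul1r // pnatr_eq0 -lt0n.
(* A violation at [n] pushes one of the two powers over its threshold at time m n, because the decay
   of the base offsets the growth sqrt (n / t). *)
have sub : B `<=` (G `&` B) `|` (E1 `&` B `|` E2 `&` B).
  move=> w Bw; have [E1w|nE1] := pselect (E1 w); first by right; left.
  have [E2w|nE2] := pselect (E2 w); first by right; right.
  left; split; [move=> n tn; rewrite Bw|exact: Bw].
  have Nn : (m * t <= m * n)%N by rewrite leq_pmul2l.
  split; rewrite ltNge; apply/negP => H.
    apply: nE2; exists (m * n)%N => //; apply: inv_pow_ge => //.
    rewrite -degE /b2 !mulNr lerN2 -[leLHS]mulrA -[leRHS]mulrA ler_wpM2l //.
    set s := Num.sqrt _.
    apply: le_trans (_ : s * ((1 - eps) * Num.sqrt (n%:R / t%:R) * d%:R) <= _).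
      by rewrite ler_wpM2l ?sqrtr_ge0.
    have := @lower_base_ratio _ (m * t) (m * n) eps e0 _ etN.
    rewrite -/s natE => r; rewrite mulrA ler_wpM2r // mulrCA; apply: r; lra.
  apply: nE1; exists (m * n)%N => //; apply: inv_pow_ge; first exact: b1_lt1.
  rewrite -degE /b1 -[leLHS]mulrA -[leRHS]mulrA ler_wpM2l //.
  apply: le_trans (ler_wpM2l (sqrtr_ge0 _) H).
  have := @sqrt_mulV R (m * t)%:R (m * n)%:R (k0 _ _) (k0 _ _).
  rewrite natE => r; rewrite [_ * Num.sqrt _]mulrC !mulrA r ?mul1r //.
have prG : pr P B <= pr P (G `&` B) + (e * pr P B + e * pr P B).
  have m1 := measurableI _ _ mE1 mB; have m2 := measurableI _ _ mE2 mB.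
  have m12 := measurableU _ _ m1 m2.
  have h := pr_le_setU P mG m12 mB sub.
  have h' := pr_le_setU P m1 m2 m12 (fun _ x => x).
  apply: (le_trans h); rewrite lerD2l; apply: (le_trans h').
  by apply: lerD; [apply: (le_trans pE1)|apply: (le_trans pE2)];
    rewrite ler_wpM2r ?pr_ge0.
rewrite /cond_prob -!/(pr _ _) ler_pdivlMr //.
have l2 := @ln15_ge2 R t; rewrite ltr1n in t1; have {}l2 := l2 t1.
have e_ge0 : 0 <= e by exact: expR_ge0.
(* The two tails together cost 2 e, which the logarithm dominates. *)
have : 2 * (e * pr P B) <= ln (15 * t%:R) * (e * pr P B).
  by rewrite ler_wpM2r ?mulr_ge0 // ltW.
by lra.
Qed.
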